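(* Consider the following two-player zero-sum absorbing game (a variant of the Big Match) in which player 2 observes the past actions played whereas player 1 does not. There is one nonabsorbing state $s$, the initial state, and two absorbing states $0^*,1^*$ with stage payoffs $0$ and $1$ respectively. Player 1 has actions $I=\{T,B\}$ and player 2 has actions $J=\{L,R\}$. In state $s$: $(T,L)$ gives payoff $1$ and leads to $1^*$; $(T,R)$ gives payoff $0$ and leads to $0^*$; $(B,L)$ gives stage payoff $0$ and the state stays $s$; $(B,R)$ gives stage payoff $1$ and the state stays $s$. Then the game with the sup evaluation has a value $v^s=1$. The game with the limsup evaluation and the game with the limsup-mean evaluation do not have a value: $$\underline v^*=\underline v^*_m=0<\tfrac12=\overline v^*_m=\overline v^*.$$
   Context: At each stage $n\ge1$ the players independently choose $i_n\in I$ and $j_n\in J$, the stage payoff (paid to player 1) is $g(x_n,i_n,j_n)$, where $x_n$ is the current state. Player 1 receives no signal (he remembers only his own past actions): a behavioral strategy of player 1 is a sequence $\sigma=(\sigma_n)_{n\ge1}$ with $\sigma_n:I^{n-1}\to\Delta(I)$. Player 2 observes all past actions: a behavioral strategy of player 2 is a sequence $\tau=(\tau_n)_{n\ge1}$ with $\tau_n:(I\times J)^{n-1}\to\Delta(J)$. $\mathbb E_{\sigma,\tau}$ is the expectation for the induced probability on plays. For an evaluation $f$ of plays, the maxmin is $\sup_\sigma\inf_\tau\mathbb E_{\sigma,\tau}(f)$, the minmax is $\inf_\tau\sup_\sigma\mathbb E_{\sigma,\tau}(f)$, and the value exists if they are equal, in which case it is their common value. The sup evaluation is $\gamma^s(h)=\sup_{n\ge1}g(x_n,i_n,j_n)$,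 with value $v^s$; the limsup evaluation is $\gamma^*(h)=\limsup_n g(x_n,i_n,j_n)$, with maxmin $\underline v^*$ and minmax $\overline v^*$; the limsup-mean evaluation is $\gamma^*_m(h)=\limsup_n\frac1n\sum_{t=1}^n g(x_t,i_t,j_t)$, with maxmin $\underline v^*_m$ and minmax $\overline v^*_m$. *)

(* Defs.v *)
From HB Require Import structures.
From mathcomp Require Import all_boot all_order all_algebra.
From mathcomp Require Import all_classical all_reals all_analysis.
Set Implicit Arguments.
Unset Strict Implicit.
Unset Printing Implicit Defensive.
Import Order.TTheory GRing.Theory Num.Theory.
Import numFieldNormedType.Exports.
Local Open Scope classical_set_scope.
Local Open Scope ring_scope.

(** * The absorbing game *)

Inductive action1 := actT | actB.
Inductive action2 := actL | actR.
(* [st_0] and [st_1] are the absorbing states 0* and 1*. *)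
Inductive state := st_s | st_0 | st_1.

Definition is_T i := if i is actT then true else false.
Definition is_L j := if j is actL then true else false.

Lemma is_TK : cancel is_T (fun b : bool => if b then actT else actB).
Proof. by case. Qed.

Lemma is_LK : cancel is_L (fun b : bool => if b then actL else actR).
Proof. by case. Qed.

HB.instance Definition _ := Finite.copy action1 (can_type is_TK).
HB.instance Definition _ := Finite.copy action2 (can_type is_LK).
HB.instance Definition _ := isPointed.Build action1 actB.
HB.instance Definition _ := isPointed.Build action2 actL.

Definition next_state (x : state) (i : action1) (j : action2) : state :=
  match x, i, j with
  | st_s, actT, actL => st_1
  | st_s, actT, actR => st_0
  | x, _, _ => x
  end.

Definition payoff (R : realType) (x : state) (i : action1) (j : action2) : R :=
  match x, i, j with
  | st_s, actT, actL => 1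
  | st_s, actT, actR => 0
  | st_s, actB, actL => 0
  | st_s, actB, actR => 1
  | st_0, _, _ => 0
  | st_1, _, _ => 1
  end.

(** * Plays

   Transitions are deterministic, so a play is given by its sequence of action
   pairs, and the states are functions of it.  Stages are numbered from 0:
   [h n] is the pair of actions of the (n+1)-st stage. *)

Definition actions : Type := (action1 * action2)%type.

Definition cylinder (h : nat -> actions) (n : nat) : set (nat -> actions) :=
  [set h' | forall k, (k < n)%N -> h' k = h k].

Definition cylinders : set (set (nat -> actions)) :=
  [set C | exists h n, C = cylinder h n].

Definition play : Type := g_sigma_algebraType cylinders.
HB.instance Definition _ := Measurable.on play.

Fixpoint state_at (h : nat -> actions) (n : nat) : state :=
  if n is m.+1 then next_state (state_at h m) (h m).1 (h m).2 else st_s.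

Definition stage_payoff (R : realType) (h : nat -> actions) (n : nat) : R :=
  payoff R (state_at h n) (h n).1 (h n).2.

(** * Strategies and the induced probability on plays *)

Record mixed (R : realType) (A : finType) := Mixed {
  mixed_fun :> A -> R ;
  mixed_ge0 : forall a, 0 <= mixed_fun a ;
  mixed_sum1 : \sum_a mixed_fun a = 1 }.

(* [sigma n] is used at the (n+1)-st stage. *)
Definition strategy1 (R : realType) := forall n, n.-tuple action1 -> mixed R action1.
Definition strategy2 (R : realType) := forall n, n.-tuple actions -> mixed R action2.

Definition history (h : nat -> actions) (n : nat) : n.-tuple actions :=
  [tuple h k | k < n].

Definition history1 (h : nat -> actions) (n : nat) : n.-tuple action1 :=
  [tuple (h k).1 | k < n].

(* Probability that the first [n] stages are played as in [h]: at each stage the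
   two players randomize independently, player 1 knowing only his own past
   actions. *)
Definition cylinder_prob (R : realType) (sigma : strategy1 R)
    (tau : strategy2 R) (h : nat -> actions) (n : nat) : R :=
  \prod_(k < n) (sigma k (history1 h k) (h k).1 * tau k (history h k) (h k).2).

Definition is_play_law (R : realType) (sigma : strategy1 R)
    (tau : strategy2 R) (P : probability play R) : Prop :=
  forall h n, P (cylinder h n) = (cylinder_prob sigma tau h n)%:E.

(* Existence of a probability on plays with prescribed transition
   probabilities [q] from the finite past to the next pair of actions: it is
   the image of the uniform law on [0, 1) by the map [Y] below, where the
   cylinder of a finite history corresponds to a half-open interval and the
   next pair of actions is read off by subdividing this interval. *)
Section play_law_construction.
Variables (R : realType) (q : seq actions -> actions -> R).
Hypothesis q_ge0 : forall s a, 0 <= q s a.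
Hypothesis q_sum1 : forall s, \sum_a q s a = 1.

Let cumul (s : seq actions) (i : nat) : R :=
  \sum_(a | (enum_rank a < i)%N) q s a.

Let cumul0 s : cumul s 0 = 0.
Proof. by rewrite /cumul big_pred0. Qed.

Let cumul_full s : cumul s #|{: actions}| = 1.
Proof.
by rewrite -(q_sum1 s); apply: eq_bigl => a; rewrite ltn_ord.
Qed.

Let cumulS s (a : actions) :
  cumul s (enum_rank a).+1 = cumul s (enum_rank a) + q s a.
Proof.
rewrite /cumul (bigD1 a) /= ?ltnSn// addrC; congr (_ + _).
apply: eq_bigl => b; rewrite ltnS ltn_neqAle andbC; congr andb.
by rewrite -(inj_eq (@enum_rank_inj actions)) -val_eqE.
Qed.

Let cumul_le s i j : (i <= j)%N -> cumul s i <= cumul s j.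
Proof.
move=> ij; rewrite /cumul [leRHS](bigID (fun a => (enum_rank a < i)%N)) /=.
rewrite [X in _ <= X + _](eq_bigl (fun a => (enum_rank a < i)%N)); last first.
  by move=> a; rewrite andbC; case: ltnP => //= /leq_trans ->.
by rewrite lerDl sumr_ge0.
Qed.

Let cumul_ge0 s i : 0 <= cumul s i. Proof. exact: sumr_ge0. Qed.

Let pre (h : nat -> actions) n := mkseq h n.
Let pr h n : R := \prod_(k < n) q (pre h k) (h k).
Let lo h n : R := \sum_(k < n) pr h k * cumul (pre h k) (enum_rank (h k)).
Let itv h n : set R := `[lo h n, lo h n + pr h n[.
Let child h n (a : actions) : set R :=
  `[lo h n + pr h n * cumul (pre h n) (enum_rank a),
    lo h n + pr h n * cumul (pre h n) (enum_rank a).+1[.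

Let pr_ge0 h n : 0 <= pr h n. Proof. exact: prodr_ge0. Qed.

Let preE h h' n : (forall k, (k < n)%N -> h k = h' k) -> pre h n = pre h' n.
Proof.
move=> hh'; apply/eq_in_map => k; rewrite mem_iota add0n => /andP[_].
exact: hh'.
Qed.

Let prE h h' n : (forall k, (k < n)%N -> h k = h' k) -> pr h n = pr h' n.
Proof.
move=> hh'; apply: eq_bigr => k _; rewrite hh'// (@preE h h' k)// => l lk.
by apply: hh'; exact: ltn_trans lk (ltn_ord k).
Qed.

Let loE h h' n : (forall k, (k < n)%N -> h k = h' k) -> lo h n = lo h' n.
Proof.
move=> hh'; apply: eq_bigr => k _; have hk l : (l < k)%N -> h l = h' l.
  by move=> lk; apply: hh'; exact: ltn_trans lk (ltn_ord k).
by rewrite hh'// (preE hk) (prE hk).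
Qed.

Let childE h h' n : (forall k, (k < n)%N -> h k = h' k) -> child h n = child h' n.
Proof. by move=> hh'; apply/funext => a; rewrite /child (loE hh') (prE hh') (preE hh'). Qed.

Let itvS h n : itv h n.+1 = child h n (h n).
Proof.
rewrite /itv /child cumulS /lo big_ord_recr /= /pr big_ord_recr /=.
by rewrite -addrA -mulrDr.
Qed.

Let itv0 h : itv h 0 = `[0, 1[%classic.
Proof. by rewrite /itv /lo /pr !big_ord0 add0r. Qed.

Let child_sub h n a : child h n a `<=` itv h n.
Proof.
move=> u; rewrite /child /itv /= !in_itv /= => /andP[lu ul]; apply/andP; split.
  by apply: le_trans lu; rewrite lerDl mulr_ge0.
apply: lt_le_trans ul _; rewrite lerD2l ler_piMr//.
by rewrite -(cumul_full (pre h n)) cumul_le.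
Qed.

Let child_ex h n u : itv h n u -> exists a, child h n a u.
Proof.
rewrite /itv /= in_itv /= => /andP[lu ul].
have ex : exists i, u < lo h n + pr h n * cumul (pre h n) i.
  by exists #|{: actions}|; rewrite cumul_full mulr1.
case: (ex_minnP ex) => -[|i] ui imin.
  by move: ui; rewrite cumul0 mulr0 addr0 ltNge lu.
have iA : (i < #|{: actions}|)%N.
  by apply: imin; rewrite cumul_full mulr1.
exists (enum_val (Ordinal iA)); rewrite /child /= enum_valK /= in_itv /= ui andbT.
by rewrite leNgt; apply/negP => /imin; rewrite ltnn.
Qed.

Let child_inj h n a b u : child h n a u -> child h n b u -> a = b.
Proof.
move=> ha hb; apply: contrapT => ab.
wlog rab : a b ha hb ab / (enum_rank a < enum_rank b)%N.
  move=> H; have [r|r|r] := ltngtP (enum_rank a) (enum_rank b).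
  - exact: (H a b).
  - by apply: (H b a) => // ba; apply: ab.
  - by apply: ab; apply: enum_rank_inj; exact: val_inj.
move: ha hb; rewrite /child /= !in_itv /= => /andP[_ ua] /andP[ub _].
have := lt_le_trans ua (le_trans _ ub); rewrite ltxx => /(_ _)/negP; apply => //.
by rewrite lerD2l ler_wpM2l// cumul_le.
Qed.

Let sel (u : R) h n : actions := get [set a | child h n a u].

Let G (u : R) := fix G n : nat -> actions :=
  if n is m.+1 then fun k => if (k < m)%N then G m k else sel u (G m) m
  else fun=> point.

Let X (u : R) k := G u k.+1 k.

Let G_X u n k : (k < n)%N -> G u n k = X u k.
Proof.
elim: n k => // n IH k; rewrite ltnS leq_eqVlt => /orP[/eqP->//|kn].
by rewrite /= kn IH.
Qed.

Let X_itv u : `[0, 1[%classic u -> forall n, itv (X u) n u.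
Proof.
move=> u01; elim=> [|n IH]; first by rewrite itv0.
rewrite itvS {2}/X /= ltnn /sel (childE (@G_X u n)).
exact: getPex (child_ex IH).
Qed.

Let itv_le h n : itv h n `<=` `[0, 1[%classic.
Proof.
elim: n => [|n IH]; first by rewrite itv0.
by rewrite itvS; apply: subset_trans IH; exact: child_sub.
Qed.

Let itv_X h n u : itv h n u -> cylinder h n (X u).
Proof.
elim: n => [|n IH] hu; first by move=> k.
have hnu : itv h n u by apply: (@child_sub _ _ (h n)); rewrite -itvS.
move=> k; rewrite ltnS leq_eqVlt => /orP[/eqP->|]; last exact: IH.
have := X_itv (itv_le hu) n.+1; rewrite itvS (childE (IH hnu)) => xu.
by apply: child_inj xu _; rewrite -itvS.
Qed.

Let Y (u : R) : play := if u \in `[0, 1[ then X u else point.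

Let Y_cyl h n : Y @^-1` (cylinder h n) `&` `[0, 1[%classic = itv h n.
Proof.
apply/seteqP; split => u /=.
  move=> [+ u01]; rewrite /Y u01 => yu.
  by rewrite /itv -(loE yu) -(prE yu); exact: X_itv.
by move=> hu; have u01 := itv_le hu; split => //; rewrite /Y u01; exact: itv_X.
Qed.

Let mY : measurable_fun [set: R] Y.
Proof.
apply: (measurability (rT := play) cylinders) => //.
move=> _ [_ [h [n ->]] <-]; rewrite setTI.
rewrite -(setUIDK (Y @^-1` cylinder h n) `[0, 1[%classic) Y_cyl.
apply: measurableU; first exact: measurable_itv.
have [pc|npc] := pselect (cylinder h n point).
  rewrite (_ : _ `\` _ = ~` `[0, 1[%classic).
    by apply: measurableC; exact: measurable_itv.
  apply/seteqP; split => u /=; first by case.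
  by move=> u01; split=> //; rewrite /Y ifF//; apply/negP.
rewrite (_ : _ `\` _ = set0) //; apply/seteqP; split => u //= [+ u01].
by rewrite /Y ifF//; apply/negP.
Qed.

Let m01 : measurable (`[0, 1[%classic : set R).
Proof. exact: measurable_itv. Qed.

Definition sequential_law : set play -> \bar R :=
  pushforward (mrestr (@lebesgue_measure R) m01) Y.

Let law0 : sequential_law set0 = 0%E.
Proof. by rewrite /sequential_law /pushforward preimage_set0 measure0. Qed.

Let law_ge0 A : (0 <= sequential_law A)%E.
Proof. exact: measure_ge0. Qed.

Let law_sigma_additive : semi_sigma_additive sequential_law.
Proof.
have mp A : measurable A -> measurable (Y @^-1` A).
  by move=> mA; rewrite -[X in measurable X]setTI; exact: mY.
move=> F mF tF mUF; rewrite /sequential_law /pushforward preimage_bigcup.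
apply: measure_semi_sigma_additive => [n||].
- exact: mp.
- apply/trivIsetP => /= i j _ _ ij; rewrite -preimage_setI.
  by move/trivIsetP : tF => /(_ _ _ _ _ ij) ->//; rewrite preimage_set0.
- by rewrite -preimage_bigcup; exact: mp.
Qed.

HB.instance Definition _ := isMeasure.Build _ _ _ sequential_law
  law0 law_ge0 law_sigma_additive.

Let law_cyl h n : sequential_law (cylinder h n) = (pr h n)%:E.
Proof.
rewrite /sequential_law /pushforward /mrestr Y_cyl lebesgue_measure_itv /= lte_fin ltrDl.
rewrite -EFinD addrAC subrr add0r; case: ifPn => //.
by rewrite -leNgt => pr0; congr EFin; apply/eqP; rewrite eq_le pr_ge0 pr0.
Qed.

Let law_setT : sequential_law setT = 1%E.
Proof.
rewrite (_ : setT = cylinder point 0); last by apply/seteqP; split.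
by rewrite law_cyl /pr big_ord0.
Qed.

HB.instance Definition _ := Measure_isProbability.Build _ _ _ sequential_law law_setT.

Lemma sequential_law_exists : exists P : probability play R,
  forall h n, P (cylinder h n) = (\prod_(k < n) q (mkseq h k) (h k))%:E.
Proof. by exists sequential_law; exact: law_cyl. Qed.

End play_law_construction.

Lemma play_law_exists (R : realType) (sigma : strategy1 R)
  (tau : strategy2 R) : exists P, is_play_law sigma tau P.
Proof.
pose q (s : seq actions) (a : actions) : R :=
  sigma (size s) (map_tuple fst (in_tuple s)) a.1 * tau (size s) (in_tuple s) a.2.
have q_ge0 s a : 0 <= q s a by rewrite mulr_ge0 ?mixed_ge0.
have q_sum1 s : \sum_a q s a = 1.
  rewrite /q.
  rewrite -(pair_bigA _ (fun i j => sigma (size s) (map_tuple fst (in_tuple s)) i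
    * tau (size s) (in_tuple s) j)) /=.
  under eq_bigr do rewrite -mulr_sumr mixed_sum1 mulr1.
  exact: mixed_sum1.
have [P PE] := sequential_law_exists q_ge0 q_sum1.
exists P => h n; rewrite PE; congr EFin; apply: eq_bigr => k _.
have qE m (t : m.-tuple actions) a :
    q t a = sigma m (map_tuple fst t) a.1 * tau m t a.2.
  case: t => s i; have /eqP e := i; rewrite /q; subst m.
  by rewrite (_ : Tuple i = in_tuple s)//; exact: val_inj.
have -> : mkseq h k = history h k :> seq actions.
  by rewrite /mkseq /= -val_enum_ord -map_comp.
rewrite qE (_ : map_tuple _ _ = history1 h k)//.
by apply: val_inj => /=; rewrite -map_comp.
Qed.

(* The choice is immaterial: the cylinders, together with the empty set, form a
   pi-system generating the sigma-algebra, so that the law is unique. *)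
Definition play_law (R : realType) (sigma : strategy1 R) (tau : strategy2 R) :
  probability play R := projT1 (cid (play_law_exists sigma tau)).

(** * Evaluations, maxmin, minmax and value *)

Definition expected (R : realType) (sigma : strategy1 R)
    (tau : strategy2 R) (f : play -> \bar R) : \bar R :=
  (\int[play_law sigma tau]_h f h)%E.

Definition maxmin (R : realType) (f : play -> \bar R) : \bar R :=
  ereal_sup (range (fun sigma : strategy1 R =>
    ereal_inf (range (fun tau : strategy2 R => expected sigma tau f)))).

Definition minmax (R : realType) (f : play -> \bar R) : \bar R :=
  ereal_inf (range (fun tau : strategy2 R =>
    ereal_sup (range (fun sigma : strategy1 R => expected sigma tau f)))).

Definition has_value (R : realType) (f : play -> \bar R) : Prop :=
  maxmin f = minmax f.

Definition is_value (R : realType) (f : play -> \bar R) (v : \bar R) : Prop :=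
  has_value f /\ maxmin f = v.

Definition sup_eval (R : realType) (h : play) : \bar R :=
  ereal_sup (range (fun n => (stage_payoff R h n)%:E)).

Definition limsup_eval (R : realType) (h : play) : \bar R :=
  limn_esup (fun n => (stage_payoff R h n)%:E).

(* The [n]-th term is the mean over the first [n.+1] stages. *)
Definition limsup_mean_eval (R : realType) (h : play) : \bar R :=
  limn_esup (fun n => (n.+1%:R^-1 * \sum_(t < n.+1) stage_payoff R h t)%:E).

(* Main.v *)
Require Import Defs.
From mathcomp Require Import all_boot all_order all_algebra.
From mathcomp Require Import all_classical all_reals all_analysis.
From mathcomp Require Import measurable_realfun ring lra.

Set Implicit Arguments.
Unset Strict Implicit.
Unset Printing Implicit Defensive.
Import Order.TTheory GRing.Theory Num.Theory.
Import numFieldNormedType.Exports.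
Local Open Scope classical_set_scope.
Local Open Scope ring_scope.

(** The game stops at the first stage where player 1 plays T, and before that
   stage player 1 has only played B.  A strategy of player 1 is therefore the
   law of a stopping time, and all that matters in a strategy of player 2 is
   the law of the sequence of L and R that it produces as long as player 1
   plays B.  Every event needed below is built from cylinders on which player 1
   plays B, possibly followed by one T; the probability of such a cylinder is
   the product of a survival probability ([survive]), which depends on player 1
   only, and a probability of the actions of player 2 ([reply]), except that
   the final T replaces survival by its decrease.

   Sup evaluation.  Let player 1 stop at every stage with probability e.  The
   sup is less than 1 only if he stops exactly when player 2 plays R for the
   first time, or if (B,L) is played forever.  The first event has
   probability at most e, since there is only one stage at which it can
   happen, and the second has probability 0 ([prob_sup_bad]).

   Limsup and limsup-mean.  Both are the limsup of averages of the stage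
   payoffs whose weights sum to 1 and tend to 0 on each fixed stage
   ([regular_weights]).  Such an evaluation is c as soon as the payoff is
   eventually c, and the argument is the same for all of them.
   - The maxmin is 0: once the stopping time of player 1 is known, player 2
     plays R until almost all the mass of the finite values of this time is
     exhausted, then L forever ([maxmin_average]).
   - The minmax is at most 1/2: player 2 tosses a coin at the first stage and
     repeats the outcome forever.  Stopping gives 1 or 0 with equal chance,
     and so does never stopping ([minmax_average_le]).
   - The minmax is at least 1/2: player 1 knows the probability that player 2
     plays L at stage n while the game is not absorbed.  If it is at least 1/2
     for some n he stops at n.  Otherwise each stage payoff has expectation at
     least 1/2 when he never stops, and the reverse Fatou inequality for
     bounded functions gives the same bound for the limsup
     ([minmax_average_ge]). *)

(** * Plays and stage payoffs *)

(** Player 1 has not stopped before stage [n]: stages are numbered from 0. *)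
Definition alive (h : nat -> actions) n := forall k, (k < n)%N -> (h k).1 = actB.

Lemma alive_state h n : alive h n -> state_at h n = st_s.
Proof.
elim: n => //= n IH hn; rewrite IH ?hn//.
by move=> k kn; apply: hn; exact: ltnW.
Qed.

Section StagePayoffs.
Variable R : realType.
Implicit Types h : nat -> actions.

Lemma stage_payoff_ge0 h n : 0 <= stage_payoff R h n.
Proof. by rewrite /stage_payoff; case: state_at => //; case: (h n) => -[] []/=. Qed.

Lemma stage_payoff_le1 h n : stage_payoff R h n <= 1.
Proof. by rewrite /stage_payoff; case: state_at => //; case: (h n) => -[] []/=. Qed.

Lemma stage_payoff_B h n : alive h n.+1 -> stage_payoff R h n = (~~ is_L (h n).2)%:R.
Proof.
move=> hn; rewrite /stage_payoff alive_state; last first.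
  by move=> k kn; apply: hn; exact: ltnW.
by rewrite hn//; case: (h n).2.
Qed.

Lemma stage_payoff_T h n t : alive h n -> (h n).1 = actT -> (n <= t)%N ->
  stage_payoff R h t = (is_L (h n).2)%:R.
Proof.
move=> hn hT; rewrite leq_eqVlt => /orP[/eqP<-|].
  by rewrite /stage_payoff alive_state// hT; case: (h n).2.
move=> nt; have -> : stage_payoff R h t =
    payoff R (if is_L (h n).2 then st_1 else st_0) (h t).1 (h t).2.
  rewrite /stage_payoff; congr payoff.
  elim: t nt => // t IH; rewrite ltnS leq_eqVlt => /orP[/eqP<-|/IH] /=.
    by rewrite alive_state// hT; case: (h n).2.
  by move=> ->; case: is_L.
by case: is_L.
Qed.

Lemma eq_stage_payoff h h' n : (forall k, (k < n.+1)%N -> h k = h' k) ->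
  stage_payoff R h n = stage_payoff R h' n.
Proof.
move=> hh'; rewrite /stage_payoff hh'//; congr payoff.
elim: n hh' => //= n IH hh'; rewrite IH ?hh'// => k kn.
by apply: hh'; exact: ltnW.
Qed.

End StagePayoffs.

(** * Regular averages of the stage payoffs *)

Section Averages.
Variable R : realType.

(** The hypotheses of the Toeplitz theorem on regular summation, with
   nonnegative weights supported on the stages [0 .. n]. *)
Record regular_weights (w : nat -> nat -> R) : Prop := RegularWeights {
  weight_ge0 : forall n t, 0 <= w n t ;
  weight_sum1 : forall n, \sum_(t < n.+1) w n t = 1 ;
  weight_cvg0 : forall t, w n t @[n --> \oo] --> 0 }.

Definition average (w : nat -> nat -> R) (h : nat -> actions) n :=
  \sum_(t < n.+1) w n t * stage_payoff R h t.

Definition average_eval (w : nat -> nat -> R) (h : play) : \bar R :=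
  limn_esup (fun n => (average w h n)%:E).

Variables (w : nat -> nat -> R) (rw : regular_weights w).

Lemma average_ge0 h n : 0 <= average w h n.
Proof.
by apply: sumr_ge0 => t _; rewrite mulr_ge0 ?stage_payoff_ge0// weight_ge0.
Qed.

Lemma average_le1 h n : average w h n <= 1.
Proof.
rewrite -(weight_sum1 rw n); apply: ler_sum => t _.
by rewrite ler_piMr ?stage_payoff_le1// weight_ge0.
Qed.

Lemma average_eval_ge0 h : (0 <= average_eval w h)%E.
Proof.
rewrite /average_eval limn_esup_lim; apply: lime_ge; first exact: is_cvg_esups.
apply: nearW => n; apply: (@le_trans _ _ (average w h n)%:E).
  by rewrite lee_fin average_ge0.
by apply: ereal_sup_ubound; exists n => /=.
Qed.

Lemma average_eval_le1 h : (average_eval w h <= 1)%E.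
Proof.
rewrite /average_eval limn_esup_lim; apply: lime_le; first exact: is_cvg_esups.
apply: nearW => n; apply: ge_ereal_sup => _ [m _ <-].
by rewrite lee_fin average_le1.
Qed.

(** The first [N] stages have vanishing total weight, and all the other stages
   have payoff [c]. *)
Lemma average_eval_cst h N c : (forall t, (N <= t)%N -> stage_payoff R h t = c) ->
  average_eval w h = c%:E.
Proof.
move=> hc; suff avg_c : average w h n @[n --> \oo] --> c.
  rewrite /average_eval.
  suff /cvg_limn_einf_sup[_ ->] : (average w h n)%:E @[n --> \oo] --> c%:E by [].
  by apply: cvg_EFin avg_c; exact: nearW.
have c0 : 0 <= c by rewrite -(hc N)// stage_payoff_ge0.
have c1 : c <= 1 by rewrite -(hc N)// stage_payoff_le1.
pose e n : R := \sum_(t < N) w n t.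
have e0 : e n @[n --> \oo] --> 0.
  rewrite (_ : 0 = \sum_(t < N) (0 : R)); last by rewrite big1.
  apply: (@cvg_big _ _ +%R 0 predT) => [|t _]; first exact: add_continuous.
  exact: weight_cvg0.
apply/cvgrPdist_le => eps eps0.
have /cvgrPdist_le/(_ eps eps0) := e0.
apply: filterS2 (nbhs_infty_ge N) => n Nn.
rewrite sub0r normrN => /(le_trans (ler_norm _)); apply: le_trans.
have -> : c - average w h n = \sum_(t < n.+1) w n t * (c - stage_payoff R h t).
  rewrite /average -[X in X - _](mul1r c) -(weight_sum1 rw n) mulr_suml -sumrB.
  by apply: eq_bigr => t _; rewrite mulrBr.
rewrite (le_trans (ler_norm_sum _ _ _))// /e.
(* Only the terms [t < N] remain, each at most its weight; for [n] beyond [N]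
   they all occur in the average. *)
rewrite (big_ord_widen_cond n.+1 predT (fun t => w n t)) ?leqW//= big_mkcond/=.
rewrite [leRHS]big_mkcond /=.
apply: ler_sum => t _; rewrite normrM ger0_norm ?weight_ge0//.
case: ltnP => tN.
  rewrite ler_piMr ?weight_ge0// ler_norml.
  have := stage_payoff_ge0 R h t; have := stage_payoff_le1 R h t; lra.
by rewrite hc// subrr normr0 mulr0.
Qed.

End Averages.

(** * The law of the play *)

Section Law.
Variable R : realType.
Implicit Types (h : nat -> actions) (sigma : strategy1 R) (tau : strategy2 R).

Lemma play_lawP sigma tau : is_play_law sigma tau (play_law sigma tau).
Proof. exact: projT2 (cid (play_law_exists sigma tau)). Qed.

(** Membership in [A] is decided by the first [n] stages. *)
Definition horizon n (A : set play) : Prop :=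
  forall h h', (forall k, (k < n)%N -> h k = h' k) -> A h -> A h'.

Lemma horizon_cylinder h n : horizon n (cylinder h n).
Proof. by move=> h1 h2 h12 h1h k kn; rewrite -h12// h1h. Qed.

(** Only finitely many histories have length [n], so that an event decided by
   them is a finite union of cylinders; this gives measurability, and
   probabilities as finite sums. *)
Lemma horizon_bigcup n (A : set play) (a : actions) : horizon n A ->
  A = \bigcup_(t in [set t : n.-tuple actions | A (nth a t)]) cylinder (nth a t) n.
Proof.
move=> An; apply/seteqP; split => [h Ah|h [t /= At ht]]; last first.
  by apply: An At => k kn; rewrite ht.
have hE k : (k < n)%N -> nth a (history h k.+1) k = h k.
  by move=> kn; rewrite (nth_mktuple _ _ (Ordinal (ltnSn k))).
have {}hE k : (k < n)%N -> h k = nth a (history h n) k.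
  by move=> kn; rewrite (nth_mktuple _ _ (Ordinal kn)).
by exists (history h n); [apply: An Ah => k kn /=; exact: hE|move=> k /hE].
Qed.

Lemma measurable_cylinder h n : measurable (cylinder h n : set play).
Proof. by apply: sub_sigma_algebra; exists h, n. Qed.

Lemma measurable_horizon n (A : set play) : horizon n A -> measurable A.
Proof.
move=> An; rewrite (horizon_bigcup (point : actions) An).
apply: fin_bigcup_measurable => [|t _]; first exact: finite_finset.
exact: measurable_cylinder.
Qed.

(** The default value [a] of [nth] is what makes [nth a t] play the history [t]
   and then the pair [a] at stage [n]. *)
Lemma prob_horizon sigma tau n (A : set play) a : horizon n A ->
  play_law sigma tau (A `&` [set h | h n = a]) =
  (\sum_(t \in [set t : n.-tuple actions | A (nth point t)])
     (cylinder_prob sigma tau (nth a t) n.+1)%:E)%E.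
Proof.
move=> An.
have nth_point (t : n.-tuple actions) k : (k < n)%N -> nth point t k = nth a t k.
  by move=> kn; apply: set_nth_default; rewrite size_tuple.
have -> : A `&` [set h | h n = a] = \bigcup_(t in
    [set t : n.-tuple actions | A (nth point t)]) cylinder (nth a t) n.+1.
  apply/seteqP; split => [h /= [+ hn]|h /= [t At ht]].
    rewrite {1}(horizon_bigcup point An) => -[t At ht]; exists t => // k.
    rewrite ltnS leq_eqVlt => /orP[/eqP->|kn].
      by rewrite nth_default ?size_tuple.
    by rewrite ht// nth_point.
  split; last by rewrite /= ht// nth_default ?size_tuple.
  by apply: An At => k kn; rewrite ht ?nth_point// ltnW.
rewrite measure_fin_bigcup.
- by apply: eq_fsbigr => t _; exact: play_lawP.
- exact: finite_finset.
- move=> t t' _ _ [h [ht ht']]; apply: val_inj.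
  apply: (@eq_from_nth _ a) => [|k]; rewrite !size_tuple// => kn.
  by rewrite -ht ?ht'// ltnW.
- by move=> t _; exact: measurable_cylinder.
Qed.

Lemma measurable_stage_payoff n :
  measurable_fun setT (fun h : play => (stage_payoff R h n)%:E).
Proof.
apply/measurable_EFinP => _ Y _; rewrite setTI; apply: (@measurable_horizon n.+1).
by move=> h h' hh' /=; rewrite (eq_stage_payoff R hh').
Qed.

Lemma measurable_average w n :
  measurable_fun setT (fun h : play => (average (R:=R) w h n)%:E).
Proof.
apply/measurable_EFinP => _ Y _; rewrite setTI; apply: (@measurable_horizon n.+1).
move=> h h' hh' /=; suff -> : average w h n = average w h' n by [].
rewrite /average; apply: eq_bigr => t _; congr (_ * _).
by apply: eq_stage_payoff => k kt; apply: hh'; exact: leq_trans kt (ltn_ord t).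
Qed.

Lemma measurable_average_eval w : measurable_fun setT (average_eval (R:=R) w).
Proof. by apply: measurable_fun_limn_esup => n; exact: measurable_average. Qed.

Lemma measurable_sup_eval : measurable_fun setT (sup_eval R).
Proof.
rewrite (_ : sup_eval R = fun h => esups (fun n => (stage_payoff R h n)%:E) 0).
  by apply: measurable_fun_esups => n; exact: measurable_stage_payoff.
apply/funext => h; rewrite /sup_eval /esups/=; congr ereal_sup.
by apply/seteqP; split => _ [n _ <-]; exists n.
Qed.

End Law.

(** * Expectation of bounded evaluations *)

Section Expected.
Variable R : realType.
Implicit Types (sigma : strategy1 R) (tau : strategy2 R) (f : play -> \bar R).

Lemma expected_ge0 sigma tau f : (forall h, (0 <= f h)%E) -> (0 <= expected sigma tau f)%E.
Proof. by move=> f0; exact: integral_ge0. Qed.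

Lemma expected_ge_prob sigma tau f (A : set play) :
  measurable_fun setT f -> measurable A -> (forall h, (0 <= f h)%E) ->
  (forall h, A h -> (1 <= f h)%E) ->
  (play_law sigma tau A <= expected sigma tau f)%E.
Proof.
move=> mf mA f0 f1; rewrite -[A in leLHS]setIT -integral_indic//.
apply: ge0_le_integral => //.
- by apply/measurable_EFinP; exact: measurable_indic.
- move=> h _; rewrite indicE; case: (boolP (h \in A)) => [/set_mem/f1//|_].
  exact: f0.
Qed.

Lemma expected_le_prob sigma tau f (A : set play) :
  measurable_fun setT f -> measurable A -> (forall h, (0 <= f h)%E) ->
  (forall h, (f h <= 1)%E) -> (forall h, A h -> f h = 0%E) ->
  (expected sigma tau f <= 1 - play_law sigma tau A)%E.
Proof.
move=> mf mA f0 f1 fA; rewrite -probability_setC// -[X in play_law _ _ X]setIT.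
rewrite -integral_indic//; last exact: measurableC.
apply: ge0_le_integral => //.
- by apply/measurable_EFinP; apply: measurable_indic; exact: measurableC.
- move=> h _; rewrite indicE in_setC; case: (boolP (h \in A)) => [/set_mem/fA->//|_].
  exact: f1.
Qed.

Lemma expected_le1 sigma tau f : measurable_fun setT f ->
  (forall h, (0 <= f h)%E) -> (forall h, (f h <= 1)%E) -> (expected sigma tau f <= 1)%E.
Proof.
move=> mf f0 f1; apply: (le_trans (expected_le_prob _ _ mf measurable0 f0 f1 _)) => //.
by rewrite measure0 sube0.
Qed.

(** This is the reverse Fatou inequality, obtained by dominated convergence of
   the tail suprema, each of which dominates a term of the sequence. *)
Lemma expected_limsup_ge sigma tau (u : nat -> play -> \bar R) c :
  (forall n, measurable_fun setT (u n)) ->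
  (forall n h, (0 <= u n h)%E) -> (forall n h, (u n h <= 1)%E) ->
  (forall n, (c <= expected sigma tau (u n))%E) ->
  (c <= expected sigma tau (fun h => limn_esup (u ^~ h)))%E.
Proof.
move=> mu u0 u1 cu; pose s n h := esups (u ^~ h) n.
have us n h : (u n h <= s n h)%E by apply: ereal_sup_ubound; exists n => /=.
have s0 n h : (0 <= s n h)%E by exact: le_trans (us n h).
have s1 n h : (s n h <= 1)%E by apply: ge_ereal_sup => _ [m _ <-].
have ms n : measurable_fun setT (s n) by exact: measurable_fun_esups.
have [] := @dominated_convergence _ _ _ (play_law sigma tau) setT measurableT s
  (fun h => limn_esup (u ^~ h)) (cst 1%E) ms.
- exact: measurable_fun_limn_esup.
- by apply: aeW => h _; rewrite limn_esup_lim; exact: is_cvg_esups.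
- exact: finite_measure_integrable_cst.
- by apply: aeW => h n _; rewrite gee0_abs.
move=> _ _ /cvg_lim-/(_ (@ereal_hausdorff R)); rewrite /expected => <-.
apply: lime_ge.
  apply: ereal_nonincreasing_is_cvgn => m n mn; apply: ge0_le_integral => // h _.
  by apply: nonincreasing_esups.
apply: nearW => n; apply: le_trans (cu n) _.
exact: ge0_le_integral.
Qed.

End Expected.

(** * Strategies, and plays that follow a fixed sequence of player 2 *)

Section MixedActions.
Variables (R : realType) (A : finType).

Lemma pure_ge0 (a b : A) : 0 <= (b == a)%:R :> R.
Proof. exact: ler0n. Qed.

Lemma pure_sum1 (a : A) : \sum_b (b == a)%:R = 1 :> R.
Proof. by rewrite (bigD1 a)//= eqxx big1 ?addr0// => b /negbTE ->. Qed.

Definition pure (a : A) : mixed R A := Mixed (pure_ge0 a) (pure_sum1 a).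

Variables (p : R) (p01 : 0 <= p <= 1) (m m' : mixed R A).

Lemma blend_ge0 a : 0 <= p * m a + (1 - p) * m' a.
Proof.
have /andP[p0 p1] := p01.
by rewrite addr_ge0// mulr_ge0 ?mixed_ge0// subr_ge0.
Qed.

Lemma blend_sum1 : \sum_a (p * m a + (1 - p) * m' a) = 1.
Proof. by rewrite big_split /= -!mulr_sumr !mixed_sum1; ring. Qed.

Definition blend : mixed R A := Mixed blend_ge0 blend_sum1.

End MixedActions.
Arguments pure {R A} a.

Lemma mixed_le1 (R : realType) (A : finType) (m : mixed R A) a : m a <= 1.
Proof. by rewrite -(mixed_sum1 m) (bigD1 a)//= lerDl sumr_ge0// => *; exact: mixed_ge0. Qed.

Section Following.
Variable R : realType.
Implicit Types (sigma : strategy1 R) (tau : strategy2 R) (y : nat -> action2).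

Definition stay y : nat -> actions := fun k => (actB, y k).
Definition stop_at y n : nat -> actions :=
  fun k => (if k == n then actT else actB, y k).

(** The argument of [sigma k] is the only history of player 1 at which the game
   is still running. *)
Definition survive sigma n : R := \prod_(k < n) sigma k [tuple actB | _ < k] actB.

(** The probability that player 2 plays [y] during the first [n] stages, if
   player 1 keeps playing B. *)
Definition reply tau y n : R := \prod_(k < n) tau k (history (stay y) k) (y k).

Lemma sum_drops (f : nat -> R) N : \sum_(n < N) (f n - f n.+1) = f 0%N - f N.
Proof.
by elim: N => [|N IH]; rewrite ?big_ord0 ?subrr// big_ord_recr /= IH addrA subrK.
Qed.

Lemma survive_ge0 sigma n : 0 <= survive sigma n.
Proof. by apply: prodr_ge0 => k _; exact: mixed_ge0. Qed.

Lemma reply_ge0 tau y n : 0 <= reply tau y n.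
Proof. by apply: prodr_ge0 => k _; exact: mixed_ge0. Qed.

Lemma reply_le1 tau y n : reply tau y n <= 1.
Proof. by apply: prodr_ile1 => k _; rewrite mixed_ge0 mixed_le1. Qed.

Lemma eq_reply tau y y' n : (forall k, (k < n)%N -> y k = y' k) ->
  reply tau y n = reply tau y' n.
Proof.
move=> yy'; apply: eq_bigr => k _; rewrite yy'//; congr (tau k _ _).
apply: eq_from_tnth => i; rewrite !tnth_mktuple /stay yy'//.
exact: ltn_trans (ltn_ord k).
Qed.

Lemma survive_nonincreasing sigma n m : (n <= m)%N -> survive sigma m <= survive sigma n.
Proof.
elim: m => [|m IH]; first by rewrite leqn0 => /eqP->.
rewrite leq_eqVlt => /orP[/eqP->//|/IH]; apply: le_trans.
by rewrite /survive big_ord_recr /= ler_piMr ?survive_ge0// mixed_le1.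
Qed.

(** After some stage the chance of stopping at a later finite stage is small: the
   survival probabilities decrease to a limit. *)
Lemma survive_stabilizes sigma e : 0 < e ->
  exists N, forall n, survive sigma N - e <= survive sigma n.
Proof.
move=> e0; have lbS : has_inf (range (survive sigma)).
  by split; [exists (survive sigma 0), 0|exists 0 => _ [n _ <-]; exact: survive_ge0].
have [_ [N _ <-] /ltW sN] := inf_adherent e0 lbS; exists N => n.
rewrite lerBlDr (le_trans sN)// lerD2r.
by apply: ge_inf; [exact: lbS.2|exists n].
Qed.

Lemma history1_stay h n : alive h n -> history1 h n = [tuple actB | _ < n].
Proof. by move=> hn; apply: eq_from_tnth => i; rewrite !tnth_mktuple hn. Qed.

Lemma cylinder_prob_stay sigma tau y n :
  cylinder_prob sigma tau (stay y) n = survive sigma n * reply tau y n.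
Proof.
by rewrite -big_split /=; apply: eq_bigr => k _; rewrite history1_stay.
Qed.

Lemma sum_action1 (F : action1 -> R) : \sum_i F i = F actT + F actB.
Proof. by rewrite (bigD1 actT)//= (bigD1 actB)//= big1 ?addr0//; case. Qed.

Lemma sum_action2 (F : action2 -> R) : \sum_j F j = F actL + F actR.
Proof. by rewrite (bigD1 actL)//= (bigD1 actR)//= big1 ?addr0//; case. Qed.

(** Stopping at [n] has probability [survive n - survive n.+1], because player 1
   puts on T what he does not put on B; player 2 moves at stage [n] without
   seeing this T, so that his factor is the same as against B. *)
Lemma cylinder_prob_stop sigma tau y n :
  cylinder_prob sigma tau (stop_at y n) n.+1 =
  (survive sigma n - survive sigma n.+1) * reply tau y n.+1.
Proof.
have h_eq k : (k < n)%N -> stop_at y n k = stay y k.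
  by move=> kn; rewrite /stop_at ltn_eqF.
have hist_eq k : (k <= n)%N -> history (stop_at y n) k = history (stay y) k.
  move=> kn; apply: eq_from_tnth => i; rewrite !tnth_mktuple h_eq//.
  exact: leq_trans kn.
have h1 k : (k <= n)%N -> history1 (stop_at y n) k = [tuple actB | _ < k].
  by move=> kn; apply: history1_stay => i ik; rewrite h_eq// (leq_trans ik).
rewrite /cylinder_prob big_ord_recr /= h1// hist_eq// eqxx.
have -> : \prod_(k < n) (sigma k (history1 (stop_at y n) k) (stop_at y n k).1 *
    tau k (history (stop_at y n) k) (y k)) = survive sigma n * reply tau y n.
  rewrite -big_split /=; apply: eq_bigr => k _.
  by have kn := ltn_ord k; rewrite h1 1?hist_eq ?(ltnW kn)// ltn_eqF.
rewrite /reply /survive !big_ord_recr /=.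
have := mixed_sum1 (sigma n [tuple actB | _ < n]); rewrite sum_action1 => sTB.
rewrite -[X in _ = (X - _) * _]mulr1 -sTB; ring.
Qed.

(** A single infinite play is the decreasing intersection of its cylinders, so
   its probability is the limit of theirs. *)
Lemma prob_stay_forever sigma tau y p :
  (forall n, p <= survive sigma n * reply tau y n) ->
  (p%:E <= play_law sigma tau (\bigcap_n cylinder (stay y) n))%E.
Proof.
move=> py; have mc n := @measurable_cylinder (stay y) n.
have mI : measurable (\bigcap_n cylinder (stay y) n : set play) by exact: bigcapT_measurable.
have ninc : {homo cylinder (stay y) : n m / (n <= m)%N >-> (m <= n)%O}.
  by move=> n m nm; apply/subsetPset => h hm k kn; apply: hm; exact: leq_trans nm.
have fin0 : (play_law sigma tau (cylinder (stay y) 0) < +oo)%E.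
  by rewrite (le_lt_trans (probability_le1 _ _)) ?ltry//.
have cvgI := nonincreasing_cvg_mu fin0 mc mI ninc.
rewrite -(cvg_lim (@ereal_hausdorff R) cvgI); apply: lime_ge.
  by apply/cvg_ex; eexists; exact: cvgI.
by apply: nearW => n /=; rewrite play_lawP cylinder_prob_stay lee_fin.
Qed.

End Following.

(** * The sup evaluation *)

Section SupValue.
Variable R : realType.

Lemma sup_eval_ge0 h : (0 <= sup_eval R h)%E.
Proof.
apply: (@le_trans _ _ (stage_payoff R h 0)%:E); first by rewrite lee_fin stage_payoff_ge0.
by apply: ereal_sup_ubound; exists 0.
Qed.

Lemma sup_eval_le1 h : (sup_eval R h <= 1)%E.
Proof. by apply: ge_ereal_sup => _ [n _ <-]; rewrite lee_fin stage_payoff_le1. Qed.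

Lemma maxmin_le_minmax (f : play -> \bar R) : (maxmin f <= minmax f)%E.
Proof.
apply: ge_ereal_sup => _ [sigma _ <-]; apply: le_ereal_inf_tmp => _ [tau _ <-].
apply: (@le_trans _ _ (expected sigma tau f)).
  by apply: ereal_inf_lbound; exists tau.
by apply: ereal_sup_ubound; exists sigma.
Qed.

Definition hazard (e : R) (e01 : 0 <= e <= 1) : strategy1 R :=
  fun n _ => blend e01 (pure actT) (pure actB).

Lemma survive_hazard e (e01 : 0 <= e <= 1) n : survive (hazard e01) n = (1 - e) ^+ n.
Proof.
rewrite /survive (eq_bigr (fun=> 1 - e)) ?prodr_const ?card_ord// => k _ /=.
by rewrite mulr0 mulr1 add0r.
Qed.

Definition first_R n : nat -> action2 := fun k => if (k < n)%N then actL else actR.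

(** A first R at stage [n] is n times L, but not n + 1 times. *)
Lemma reply_first_R (tau : strategy2 R) n :
  reply tau (first_R n) n.+1 = reply tau (cst actL) n - reply tau (cst actL) n.+1.
Proof.
rewrite {1}/reply big_ord_recr /= -/(reply _ _ _).
rewrite (@eq_reply _ tau _ (cst actL)); last by move=> k kn; rewrite /first_R kn.
have -> : history (stay (first_R n)) n = history (stay (cst actL)) n.
  by apply: eq_from_tnth => i; rewrite !tnth_mktuple /stay /first_R ltn_ord.
rewrite {3}/reply big_ord_recr /= -/(reply _ _ _) {1}/first_R ltnn.
have := mixed_sum1 (tau n (history (stay (cst actL)) n)); rewrite sum_action2 => LR.
rewrite -[X in _ = X - _]mulr1 -LR; ring.
Qed.

(** The plays whose sup may be less than 1: player 1 stops at the first R, or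
   (B,L) is played throughout the first [N] stages. *)
Definition sup_bad N : set play :=
  \big[setU/set0]_(n < N) cylinder (stop_at (first_R n) n) n.+1
  `|` cylinder (stay (cst actL)) N.

(** Consider the first stage at which (B,L) is not played: outside the bad
   event the pair played there is (B,R) or (T,L), which both pay 1. *)
Lemma sup_eval_good N h : ~ sup_bad N h -> (1 <= sup_eval R h)%E.
Proof.
move=> bad; suff [n n1] : exists n, stage_payoff R h n = 1.
  by rewrite -n1; apply: ereal_sup_ubound; exists n.
have nBL : exists n, h n != (actB, actL).
  apply: contrapT => H; apply: bad; right => k _.
  by apply/eqP; apply: contrapT => /negP hk; apply: H; exists k.
case: (ex_minnP nBL) => n hn nmin; exists n.
have hBL k : (k < n)%N -> h k = (actB, actL).
  by move=> kn; apply/eqP; apply: contraTT kn => /nmin; rewrite -leqNgt.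
have nN : (n < N)%N.
  rewrite ltnNge; apply/negP => Nn; apply: bad; right => k kN.
  by rewrite hBL// (leq_trans kN).
have al : alive h n by move=> k /hBL->.
case hE : (h n) hn => [[] []] // _.
- by rewrite (stage_payoff_T R al) ?hE.
- exfalso; apply: bad; left.
  rewrite -(bigcup_mkord N (fun n => cylinder (stop_at (first_R n) n) n.+1 : set play)).
  exists n => // k.
  rewrite ltnS leq_eqVlt => /orP[/eqP->|kn].
    by rewrite /stop_at eqxx /first_R ltnn.
  by rewrite /stop_at ltn_eqF// /first_R kn hBL.
- rewrite stage_payoff_B ?hE// => k; rewrite ltnS leq_eqVlt => /orP[/eqP->|/al//].
  by rewrite hE.
Qed.

Lemma measurable_sup_bad N : measurable (sup_bad N).
Proof.
apply: measurableU; last exact: measurable_cylinder.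
by apply: bigsetU_measurable => n _; exact: measurable_cylinder.
Qed.

(** Given that the first R occurs at stage [n], player 1 stops exactly there with
   probability at most [e]; the probabilities of the possible places of the
   first R add up to at most 1.  The term [(1 - e) ^+ N] is the chance of not
   stopping during [N] stages. *)
Lemma prob_sup_bad e (e01 : 0 <= e <= 1) tau N :
  (play_law (hazard e01) tau (sup_bad N) <= (e + (1 - e) ^+ N)%:E)%E.
Proof.
have /andP[e0 e1] := e01; pose P := play_law (hazard e01) tau.
pose stop n : set play := cylinder (stop_at (first_R n) n) n.+1.
have mstop : measurable (\big[setU/set0]_(n < N) stop n).
  by apply: bigsetU_measurable => n _; exact: measurable_cylinder.
apply: (@le_trans _ _ (P (\big[setU/set0]_(n < N) stop n)
    + P (cylinder (stay (cst actL)) N))%E).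
  by apply: measureU2 => //; exact: measurable_cylinder.
rewrite EFinD leeD//; last first.
  rewrite /P play_lawP cylinder_prob_stay survive_hazard lee_fin.
  by rewrite ler_piMr ?reply_le1// exprn_ge0// subr_ge0.
apply: (@le_trans _ _ (\sum_(n < N) P (stop n))%E).
  apply: (content_subadditive P (F := stop)) => // n _; exact: measurable_cylinder.
pose l n := reply tau (cst actL) n.
rewrite (eq_bigr (fun n : 'I_N => ((1 - e) ^+ n * e * (l n - l n.+1))%:E)); last first.
  move=> n _; rewrite /P play_lawP cylinder_prob_stop reply_first_R !survive_hazard.
  by congr EFin; rewrite exprS /l; ring.
rewrite sumEFin lee_fin.
apply: (@le_trans _ _ (\sum_(n < N) e * (l n - l n.+1))).
  apply: ler_sum => n _; apply: ler_wpM2r.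
    by rewrite /l -reply_first_R reply_ge0.
  by rewrite ler_piMl// exprn_ile1 ?subr_ge0// gerBl.
rewrite -mulr_sumr ler_piMr//.
rewrite sum_drops (le_trans (_ : _ <= l 0))//; last exact: reply_le1.
by rewrite gerBl reply_ge0.
Qed.

Lemma sup_value : is_value (sup_eval R) 1.
Proof.
have le1 : (minmax (sup_eval R) <= 1)%E.
  apply: (@le_trans _ _ (ereal_sup (range (fun sigma : strategy1 R =>
      expected sigma (fun _ _ => pure actL) (sup_eval R))))).
    by apply: ereal_inf_lbound; exists (fun _ _ => pure actL).
  apply: ge_ereal_sup => _ [sigma _ <-].
  by apply: expected_le1; [exact: measurable_sup_eval|exact: sup_eval_ge0|exact: sup_eval_le1].
suff ge1 : (1 <= maxmin (sup_eval R))%E.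
  have eq1 : maxmin (sup_eval R) = 1%E.
    by apply/eqP; rewrite eq_le ge1 (le_trans (maxmin_le_minmax _)).
  split=> //; rewrite /has_value eq1; apply/eqP.
  by rewrite eq_le le1 andbT -{1}eq1 maxmin_le_minmax.
apply/lee_addgt0Pr => d d0; rewrite -leeBlDr//.
pose e := Num.min (d / 2) 1.
have e0 : 0 < e by rewrite lt_min divr_gt0//=.
have e1 : e <= 1 by rewrite ge_min lexx orbT.
have ed : e <= d / 2 by rewrite ge_min lexx.
have e01 : 0 <= e <= 1 by rewrite ltW.
have [N eN] : exists N, (1 - e) ^+ N <= d / 2.
  have z1 : `|1 - e| < 1 by rewrite ger0_norm ?subr_ge0// gtrBl.
  have /cvgrPdist_le/(_ (d / 2)) := cvg_expr z1.
  rewrite divr_gt0// => /(_ isT) [N _ /(_ N (leqnn N))] /=.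
  by rewrite sub0r normrN => /(le_trans (ler_norm _)); exists N.
apply: (@le_trans _ _ (ereal_inf (range (fun tau =>
    expected (hazard e01) tau (sup_eval R))))); last first.
  by apply: ereal_sup_ubound; exists (hazard e01).
apply: le_ereal_inf_tmp => _ [tau _ <-].
have mbad := measurable_sup_bad N.
apply: (@le_trans _ _ (play_law (hazard e01) tau (~` sup_bad N))); last first.
  apply: expected_ge_prob; [exact: measurable_sup_eval|exact: measurableC|
    exact: sup_eval_ge0|exact: sup_eval_good].
rewrite probability_setC//; apply: leeB => //.
apply: le_trans (prob_sup_bad e01 tau N) _; rewrite lee_fin; lra.
Qed.

End SupValue.

(** * The limsup evaluations: upper bounds *)

Section Upper.
Variable R : realType.
Variables (w : nat -> nat -> R) (rw : regular_weights w).

(** This bound serves both for the maxmin and for the minmax.  The evaluation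
   vanishes if player 1 stops before stage [N] when player 2 has played R all
   along, which absorbs in 0*, and on the infinite play where player 1 never
   stops and player 2 plays [y], which ends with L forever.  These plays have
   total probability at least
   [p * (1 - survive N) + p * (survive N - e)], hence at least [p - e]. *)
Lemma expected_average_eval_le (sigma : strategy1 R) (tau : strategy2 R) y M N p e :
  (forall t, (M <= t)%N -> y t = actL) -> 0 <= p <= 1 -> 0 <= e ->
  (forall n, survive sigma N - e <= survive sigma n) ->
  (forall n, (n <= N)%N -> p <= reply tau (cst actR) n) ->
  (forall n, p <= reply tau y n) ->
  (expected sigma tau (average_eval w) <= (1 - p + e)%:E)%E.
Proof.
move=> yL /andP[p0 p1] e0 sN pR py; pose P := play_law sigma tau.
pose stop n : set play := cylinder (stop_at (cst actR) n) n.+1.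
pose forever : set play := \bigcap_n cylinder (stay y) n.
have mstop n : measurable (stop n) by exact: measurable_cylinder.
have mforever : measurable forever.
  by apply: bigcapT_measurable => n; exact: measurable_cylinder.
have mU : measurable (\big[setU/set0]_(n < N) stop n) by exact: bigsetU_measurable.
apply: (le_trans (expected_le_prob _ _ _ (measurableU _ _ mU mforever) _ _ _)).
- exact: measurable_average_eval.
- exact: average_eval_ge0.
- exact: average_eval_le1.
- move=> h [|hy].
    rewrite -(bigcup_mkord N stop) => -[n _ hn].
    have hE k : (k <= n)%N -> h k = stop_at (cst actR) n k by exact: (hn k).
    have hT : (h n).1 = actT by rewrite hE// /stop_at eqxx.
    have al : alive h n by move=> k kn; rewrite hE ?(ltnW kn)// /stop_at ltn_eqF.
    by apply: (average_eval_cst rw (N := n)) => t nt; rewrite (stage_payoff_T _ al hT nt) hE.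
  have hE k : h k = stay y k by exact: (hy k.+1).
  apply: (average_eval_cst rw (N := M)) => t Mt; rewrite stage_payoff_B.
    by rewrite hE /= yL.
  by move=> k _; rewrite hE.
rewrite -/P measureU//; last first.
  rewrite -subset0 => h [+ hy]; rewrite -(bigcup_mkord N stop) => -[n _ /(_ n (ltnSn n))].
  by rewrite (hy n.+1)//= /stop_at eqxx.
have tI : trivIset setT stop.
  apply/trivIsetP => n m _ _; rewrite neq_ltn => nm; rewrite -subset0 => h [hn hm].
  wlog {nm} nm : n m hn hm / (n < m)%N.
    by move=> H; case/orP: nm => nm; [exact: (H n m)|exact: (H m n)].
  have := hn n (ltnSn n); rewrite (hm n (leqW nm)).
  by rewrite /stop_at eqxx ltn_eqF.
rewrite measure_bigsetU//.
rewrite (eq_bigr (fun n : 'I_N => ((survive sigma n - survive sigma n.+1) *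
    reply tau (cst actR) n.+1)%:E)); last first.
  by move=> n _; rewrite -cylinder_prob_stop; exact: play_lawP.
rewrite sumEFin.
have -> : (1 - p + e)%:E = (1 - (p - e)%:E)%E by rewrite -EFinB; congr EFin; ring.
apply: leeB => //.
apply: (@le_trans _ _ (p * (1 - survive sigma N) + p * (survive sigma N - e))%:E).
  by rewrite lee_fin; nra.
rewrite EFinD; apply: leeD.
  rewrite lee_fin -[X in X - _](_ : survive sigma 0 = 1); last by rewrite /survive big_ord0.
  rewrite -sum_drops mulr_sumr; apply: ler_sum => n _; rewrite mulrC.
  by apply: ler_wpM2l; [rewrite subr_ge0 survive_nonincreasing|exact: pR].
apply: prob_stay_forever => n; rewrite mulrC.
apply: (@le_trans _ _ (survive sigma n * p)); first by rewrite ler_wpM2r.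
by rewrite ler_wpM2l ?survive_ge0.
Qed.

(** Against a known [sigma], player 2 plays R up to a stage after which [sigma]
   is unlikely to stop at a finite stage, then L; here [p = 1]. *)
Lemma maxmin_average : maxmin (average_eval w) = 0%E.
Proof.
apply/eqP; rewrite eq_le; apply/andP; split; last first.
  apply: (@le_trans _ _ (ereal_inf (range (fun tau =>
      expected (fun _ _ => pure actB) tau (average_eval w))))).
    apply: le_ereal_inf_tmp => _ [tau _ <-]; apply: expected_ge0 => h.
    exact: average_eval_ge0.
  by apply: ereal_sup_ubound; exists (fun _ _ => pure actB).
apply: ge_ereal_sup => _ [sigma _ <-]; apply/lee_addgt0Pr => e e0; rewrite add0e.
have [N sN] := survive_stabilizes sigma e0.
pose y k := if (k < N)%N then actR else actL.
pose tau : strategy2 R := fun k _ => pure (y k).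
have ry n : reply tau y n = 1 by rewrite /reply big1// => k _ /=; rewrite eqxx.
apply: (@le_trans _ _ (expected sigma tau (average_eval w))).
  by apply: ereal_inf_lbound; exists tau.
have -> : e = 1 - 1 + e by ring.
apply: (@expected_average_eval_le _ _ y N N 1) => //.
- by move=> t Nt; rewrite /y ltnNge Nt.
- by rewrite ler01 lexx.
- exact: ltW.
- move=> n nN; rewrite (@eq_reply _ _ _ y) ?ry// => k kn.
  by rewrite /y (leq_trans kn).
- by move=> n; rewrite ry.
Qed.

Lemma half01 : 0 <= (1 / 2 : R) <= 1.
Proof. by apply/andP; split; lra. Qed.

Definition toss_and_repeat : strategy2 R := fun n =>
  match n with
  | 0 => fun _ => blend half01 (pure actL) (pure actR)
  | m.+1 => fun past => pure (thead past).2
  end.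

Lemma reply_toss_and_repeat j n : 1 / 2 <= reply toss_and_repeat (cst j) n.
Proof.
case: n => [|n]; first by rewrite /reply big_ord0; lra.
rewrite /reply big_ord_recl /= big1 ?mulr1.
  by case: j => /=; lra.
by move=> k _; rewrite /= /thead tnth_mktuple /= eqxx.
Qed.

(** Each of the two constant sequences has probability 1/2, so that [p = 1/2],
   for every [sigma] and at every horizon [N]. *)
Lemma minmax_average_le : (minmax (average_eval w) <= (1 / 2 : R)%:E)%E.
Proof.
apply: (@le_trans _ _ (ereal_sup (range (fun sigma =>
    expected sigma toss_and_repeat (average_eval w))))).
  by apply: ereal_inf_lbound; exists toss_and_repeat.
apply: ge_ereal_sup => _ [sigma _ <-]; apply/lee_addgt0Pr => e e0.
have [N sN] := survive_stabilizes sigma e0.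
rewrite -EFinD (_ : 1 / 2 + e = 1 - 1 / 2 + e); last by field.
apply: (@expected_average_eval_le _ _ (cst actL) 0 N) => //.
- exact: half01.
- exact: ltW.
- by move=> n _; exact: reply_toss_and_repeat.
- by move=> n; exact: reply_toss_and_repeat.
Qed.

End Upper.

(** * The limsup evaluations: lower bound on the minmax *)

Section Lower.
Variable R : realType.
Variables (w : nat -> nat -> R) (rw : regular_weights w).
Implicit Types tau : strategy2 R.

Definition never_stop : strategy1 R := fun _ _ => pure actB.
Definition stop_time n : strategy1 R :=
  fun k _ => pure (if k == n then actT else actB).

Definition alive_set n : set play := [set h | alive h n].

Lemma horizon_alive n : horizon n (alive_set n).
Proof. by move=> h h' hh' hn k kn; rewrite -hh'// hn. Qed.

Lemma measurable_alive_at n a : measurable (alive_set n `&` [set h | h n = a]).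
Proof.
apply: (@measurable_horizon n.+1) => h h' hh' [hn ha]; split.
  by apply: horizon_alive hn => k kn; rewrite hh'// ltnW.
by rewrite /= -hh'.
Qed.

(** Both strategies play B before stage [n], and player 2 chooses his action at
   stage [n] before seeing whether player 1 stops. *)
Lemma prob_stop_time tau n j :
  play_law (stop_time n) tau (alive_set n `&` [set h | h n = (actT, j)]) =
  play_law never_stop tau (alive_set n `&` [set h | h n = (actB, j)]).
Proof.
rewrite !(prob_horizon _ _ _ (@horizon_alive n)); apply: eq_fsbigr => t /set_mem al.
have st (k : nat) a : (k < n)%N -> nth a t k = nth point t k.
  by move=> kn; apply: set_nth_default; rewrite size_tuple.
have nt a : nth a t n = a by rewrite nth_default ?size_tuple.
rewrite /cylinder_prob !big_ord_recr /= !nt eqxx !mul1r; congr (_ * _)%:E.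
  apply: eq_bigr => k _; rewrite !st// al// ltn_eqF//; congr (_ * tau k _ _).
  by apply: eq_from_tnth => i; rewrite !tnth_mktuple !st// (ltn_trans (ltn_ord i)).
congr (tau n _ _).
by apply: eq_from_tnth => i; rewrite !tnth_mktuple !st.
Qed.

Lemma prob_never_stop_T tau n j :
  play_law never_stop tau (alive_set n `&` [set h | h n = (actT, j)]) = 0%E.
Proof.
rewrite (prob_horizon _ _ _ (@horizon_alive n)) fsbig1// => t _.
by rewrite /cylinder_prob big_ord_recr /= nth_default ?size_tuple//= mul0r mulr0.
Qed.

(** Each step removes the two events where T is played at stage [n], which are
   null. *)
Lemma prob_alive tau n : play_law never_stop tau (alive_set n) = 1%E.
Proof.
elim: n => [|n IH].
  by rewrite (_ : alive_set 0 = setT) ?probability_setT//; apply/seteqP; split.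
pose T_with j : set play := alive_set n `&` [set h | h n = (actT, j)].
have mT j : measurable (T_with j) by exact: measurable_alive_at.
have T0 : play_law never_stop tau (T_with actL `|` T_with actR) = 0%E.
  by rewrite measureU0//; exact: prob_never_stop_T.
rewrite -IH (_ : alive_set n = alive_set n.+1 `|` (T_with actL `|` T_with actR)).
  have mA := measurable_horizon (@horizon_alive n.+1).
  by rewrite (measureU0 mA (measurableU _ _ (mT _) (mT _)) T0).
apply/seteqP; split => [h hn|h [hn|[[]|[]]]//]; last first.
  by move=> k kn; apply: hn; exact: ltnW.
case hE : (h n) => [[] []]; [by right; left|by right; right|left|left].
all: by move=> k; rewrite ltnS leq_eqVlt => /orP[/eqP->|/hn//]; rewrite hE.
Qed.

Lemma prob_never_stop_LR tau n :
  (play_law never_stop tau (alive_set n `&` [set h | h n = (actB, actL)]) +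
   play_law never_stop tau (alive_set n `&` [set h | h n = (actB, actR)]) = 1)%E.
Proof.
rewrite -measureU ?(prob_alive tau n.+1)//; try exact: measurable_alive_at.
  rewrite -(prob_alive tau n.+1); congr (play_law _ _ _).
  apply/seteqP; split => [h [[hn ha]|[hn ha]]|h hn]/=.
  - by move=> k; rewrite ltnS leq_eqVlt => /orP[/eqP->|/hn//]; rewrite ha.
  - by move=> k; rewrite ltnS leq_eqVlt => /orP[/eqP->|/hn//]; rewrite ha.
  have al : alive h n by move=> k kn; apply: hn; exact: ltnW.
  by have := hn n (ltnSn n); case hE : (h n) => [[] []]//= _; [left|right].
by rewrite -subset0 => h [[_ /= ->] [_]].
Qed.

(** An average with weights of sum 1 keeps a common lower bound on the
   expectations. *)
Lemma expected_average_ge sigma tau (c : R) :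
  (forall t, (c%:E <= expected sigma tau (fun h => (stage_payoff R h t)%:E))%E) ->
  forall n, (c%:E <= expected sigma tau (fun h => (average w h n)%:E))%E.
Proof.
move=> cg n; pose g t (h : play) := (stage_payoff R h t)%:E.
have mg t : measurable_fun setT (g t) by exact: measurable_stage_payoff.
have g0 t h : (0 <= g t h)%E by rewrite lee_fin stage_payoff_ge0.
have -> : expected sigma tau (fun h => (average w h n)%:E) =
    (\sum_(t < n.+1) (w n t)%:E * expected sigma tau (g t))%E.
  rewrite /expected; under eq_integral do rewrite -sumEFin.
  rewrite ge0_integral_sum//.
  - apply: eq_bigr => t _; under eq_integral do rewrite EFinM.
    apply: ge0_integralZl_EFin => //; [by move=> h _; exact: g0|exact: mg|]. exact: weight_ge0.
  - move=> t; apply/measurable_EFinP; apply: measurable_funM => //.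
    by apply/measurable_EFinP; exact: (mg t).
  - by move=> t h _; rewrite lee_fin mulr_ge0 ?weight_ge0// stage_payoff_ge0.
rewrite -[leLHS]mul1e -(weight_sum1 rw n) -sumEFin ge0_sume_distrl; last first.
  by move=> t _; rewrite lee_fin weight_ge0.
by apply: lee_sum => t _; apply: lee_wpmul2l; [rewrite lee_fin weight_ge0|exact: cg].
Qed.

(** Player 1 stops at a stage where L has probability at least 1/2 if there is
   one.  Otherwise R has probability at least 1/2 at every stage, and he never
   stops. *)
Lemma minmax_average_ge : ((1 / 2 : R)%:E <= minmax (average_eval w))%E.
Proof.
apply: le_ereal_inf_tmp => _ [tau _ <-].
suff [sigma half] : exists sigma, ((1 / 2 : R)%:E <= expected sigma tau (average_eval w))%E.
  by apply: le_trans half _; apply: ereal_sup_ubound; exists sigma.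
pose at_n n a := alive_set n `&` [set h | h n = a].
have [[n Ln]|noL] := pselect (exists n,
    ((1 / 2 : R)%:E <= play_law never_stop tau (at_n n (actB, actL)))%E).
  exists (stop_time n); apply: le_trans Ln _; rewrite -prob_stop_time.
  apply: expected_ge_prob; first exact: measurable_average_eval.
  - exact: measurable_alive_at.
  - exact: average_eval_ge0.
  move=> h [al /= hn]; rewrite (average_eval_cst rw (N := n) (c := 1))// => t nt.
  by rewrite (stage_payoff_T _ al) ?hn.
exists never_stop; apply: expected_limsup_ge.
- by move=> n; exact: measurable_average.
- by move=> n h; rewrite lee_fin average_ge0.
- by move=> n h; rewrite lee_fin average_le1.
apply: expected_average_ge => t.
apply: (@le_trans _ _ (play_law never_stop tau (at_n t (actB, actR)))); last first.
  apply: expected_ge_prob; first exact: measurable_stage_payoff.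
  - exact: measurable_alive_at.
  - by move=> h; rewrite lee_fin stage_payoff_ge0.
  move=> h [al /= ht]; rewrite stage_payoff_B ?ht//= => k.
  by rewrite ltnS leq_eqVlt => /orP[/eqP->|/al//]; rewrite ht.
have Lt : (play_law never_stop tau (at_n t (actB, actL)) <= (1 / 2 : R)%:E)%E.
  by apply/ltW; rewrite ltNge; apply/negP => Lt; apply: noL; exists t.
have := prob_never_stop_LR tau t; rewrite -/(at_n _ _) -/(at_n _ _) => LR.
have : (1 <= (1 / 2 : R)%:E + play_law never_stop tau (at_n t (actB, actR)))%E.
  by rewrite -[leLHS]LR leeD2r.
by rewrite addeC -leeBlDr// -EFinB; apply: le_trans; rewrite lee_fin; lra.
Qed.

Lemma minmax_average : minmax (average_eval w) = (1 / 2 : R)%:E.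
Proof.
by apply/eqP; rewrite eq_le minmax_average_le// minmax_average_ge.
Qed.

End Lower.

(** * Limsup and limsup-mean as regular averages *)

Section Instances.
Variable R : realType.

Definition last_weights (n t : nat) : R := (t == n)%:R.
Definition mean_weights (n t : nat) : R := n.+1%:R^-1.

Lemma regular_last_weights : regular_weights last_weights.
Proof.
split.
- by move=> n t; exact: ler0n.
- move=> n; rewrite (bigD1 ord_max)//= /last_weights eqxx big1 ?addr0// => t /negbTE.
  by rewrite -val_eqE /= => ->.
- move=> t; apply: cvg_near_cst; exists t.+1 => // n /= tn.
  by rewrite /last_weights ltn_eqF.
Qed.

Lemma regular_mean_weights : regular_weights mean_weights.
Proof.
split.
- by move=> n t; rewrite invr_ge0.
- by move=> n; rewrite /mean_weights sumr_const card_ord -[LHS]mulr_natr mulVf.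
- by move=> t; exact: cvg_harmonic.
Qed.

Lemma limsup_evalE : limsup_eval R = average_eval last_weights.
Proof.
apply/funext => h; congr limn_esup; apply/funext => n; congr EFin.
rewrite /average (bigD1 ord_max)//= /last_weights eqxx mul1r big1 ?addr0// => t.
by rewrite -val_eqE /= => /negbTE->; rewrite mul0r.
Qed.

Lemma limsup_mean_evalE : limsup_mean_eval R = average_eval mean_weights.
Proof.
apply/funext => h; congr limn_esup; apply/funext => n; congr EFin.
by rewrite /average mulr_sumr.
Qed.

End Instances.

Local Open Scope ereal_scope.

Theorem mainTheorem6 (R : realType) :
  is_value (sup_eval R) 1 /\
  ~ has_value (limsup_eval R) /\
  ~ has_value (limsup_mean_eval R) /\
  maxmin (limsup_eval R) = maxmin (limsup_mean_eval R) /\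
  maxmin (limsup_mean_eval R) = 0 /\
  0 < (1 / 2 : R)%R%:E /\
  (1 / 2 : R)%R%:E = minmax (limsup_mean_eval R) /\
  minmax (limsup_mean_eval R) = minmax (limsup_eval R).
Proof.
have half0 : 0 < (1 / 2 : R)%R%:E by rewrite lte_fin; lra.
have no_value w : regular_weights w -> ~ has_value (average_eval (R:=R) w).
  move=> rw; rewrite /has_value maxmin_average// minmax_average// => h0.
  by rewrite -h0 ltxx in half0.
have rl := regular_last_weights R; have rm := regular_mean_weights R.
rewrite limsup_evalE limsup_mean_evalE.
rewrite (maxmin_average rl) (maxmin_average rm) (minmax_average rl) (minmax_average rm).
split; first exact: sup_value.
split; first exact: no_value rl.
by split; first exact: no_value rm.
Qed.
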